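(* For the non-preemptive mUETS problem, every online algorithm has competitive ratio $\Omega(\sqrt m)$ and $\Omega(n^{1/4})$, even when restricted to instances with unweighted type-specific setup times.
   Context: Non-preemptive mUETS: a finite set $J$ of $n$ jobs and $m$ identical machines, $n\ge m\ge 2$, all jobs available at time $0$. A known setup-time function $c:2^J\to\mathbb{R}_{\ge0}$ is monotone ($c(X)\le c(Y)$ for $X\subseteq Y$) and subadditive ($c(X)+c(Y)\ge c(X\cup Y)$ for disjoint $X,Y$). Each job $j$ has execution time $p_j\ge0$, unknown to an online algorithm until $j$ completes; $p(X)=\sum_{j\in X}p_j$. An algorithm forms batches (sets of jobs not completed and not assigned elsewhere) and may assign a batch $X$ to $k\ge1$ idle machines; each of these machines incurs setup time $c(X)$ and the jobs of $X$ are executed first-come first-served among them, so the batch is completed between $c(X)+p(X)/k$ and $c(X)+p(X)/k+\max_{j\in X}p_j$ time units after it starts. Batches are processed to completion without interruption. The makespan is the completion time of all jobs. The optimal makespan is $\min_{(X_1,\dots,X_m)\text{ partition of }J}\max_i(c(X_i)+p(X_i))$. The competitive ratio of an online algorithm is the supremum over instances of its makespan divided by the optimal makespan. Unweighted type-specific setup times: $J$ is partitioned into classes $(J_t)_{t\in T}$ (types), and $c(X)=|\{t\in T: X\cap J_t\neq\emptyset\}|$ for $X\subseteq J$. *)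

(* Defs.v *)
From HB Require Import structures.
From mathcomp Require Import all_boot all_order all_algebra.
From mathcomp Require Import classical_sets reals constructive_ereal ereal exp.
Set Implicit Arguments.
Unset Strict Implicit.
Unset Printing Implicit Defensive.
Import Order.TTheory GRing.Theory Num.Theory.
Local Open Scope ring_scope.

(* The part of an instance that is known to the online algorithm. *)
Record mUETS (R : realType) := MUETS {
  njobs : nat;
  nmach : nat;
  setup : {set 'I_njobs} -> R;
  nmach_ge2 : (2 <= nmach)%N;
  nmach_le_njobs : (nmach <= njobs)%N;
  setup_ge0 : forall X, 0 <= setup X;
  setup_mono : forall X Y : {set 'I_njobs}, X \subset Y -> setup X <= setup Y;
  setup_subadd : forall X Y : {set 'I_njobs}, [disjoint X & Y] ->
    setup (X :|: Y) <= setup X + setup Y }.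

Definition unweighted_types (R : realType) (I : mUETS R) : Prop :=
  exists2 P : {set {set 'I_(njobs I)}}, finset.partition P [set: 'I_(njobs I)] &
    forall X, setup X = #|[set B in P | X :&: B != finset.set0]|%:R.

(* At time [bstart], the jobs of [bqueue] (in this order) are assigned to the
   machines of [bmach].  The algorithm chooses the order of the queue. *)
Record batch (R : realType) (I : mUETS R) := Batch {
  bstart : R;
  bqueue : seq 'I_(njobs I);
  bmach : {set 'I_(nmach I)} }.

Record execution (R : realType) (I : mUETS R) := Execution {
  ejob : 'I_(njobs I);
  emach : 'I_(nmach I);
  ecompl : R }.

Section Schedules.
Variables (R : realType) (I : mUETS R) (p : 'I_(njobs I) -> R).

(* First-come first-served: the head of the queue goes to a machine of [K] that
   becomes free first, [free i] being the time from which machine [i] is free;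
   [pick] only breaks ties. *)
Fixpoint fcfs (K : {set 'I_(nmach I)}) (free : 'I_(nmach I) -> R)
    (q : seq 'I_(njobs I)) : seq (execution I) :=
  if q is j :: q' then
    if [pick i in K | [forall i' in K, free i <= free i']] is Some i then
      let e := free i + p j in
      Execution j i e :: fcfs K [eta free with i |-> e] q'
    else [::]
  else [::].

Definition ready (B : batch I) : R :=
  bstart B + setup [set j in bqueue B].

Definition executions (B : batch I) : seq (execution I) :=
  fcfs (bmach B) (fun=> ready B) (bqueue B).

(* When machine [i] of [bmach B] is idle again: as soon as it has no job of [B]
   left to execute, even if other machines are still busy with [B]. *)
Definition release (B : batch I) (i : 'I_(nmach I)) : R :=
  \big[Num.max/ready B]_(e <- executions B | emach e == i) ecompl e.

Definition trace (S : seq (batch I)) : seq (execution I) :=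
  flatten [seq executions B | B <- S].

Definition makespan (S : seq (batch I)) : R :=
  \big[Num.max/0]_(e <- trace S) ecompl e.

(* A schedule lists its batches in the order in which they are started; batches
   started at the same time are still ordered. *)
Definition feasible (S : seq (batch I)) : Prop :=
  [/\ path <=%R 0 [seq bstart B | B <- S],
      forall S1 B S2, S = S1 ++ B :: S2 ->
        bqueue B != [::] /\ bmach B != finset.set0,
      uniq (flatten [seq bqueue B | B <- S]),
      forall j, j \in flatten [seq bqueue B | B <- S] &
      forall S1 B S2 B' S3 i, S = S1 ++ B :: S2 ++ B' :: S3 ->
        i \in bmach B -> i \in bmach B' -> release B i <= bstart B'].

(* What has been observed by time [t] after the batches [S] were started: the
   completed jobs, with machine, completion time and execution time. *)
Definition observed (S : seq (batch I)) (t : R) : seq (execution I * R) :=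
  [seq (e, p (ejob e)) | e <- trace S & ecompl e <= t].

(* [f] encodes the partition of the jobs into the (possibly empty) sets
   X_i = f^-1(i); the infimum is over finitely many values, hence a minimum. *)
Definition opt_makespan : R :=
  inf (range (fun f : {ffun 'I_(njobs I) -> 'I_(nmach I)} =>
    \big[Num.max/0]_(i < nmach I)
      (setup [set j | f j == i] + \sum_(j | f j == i) p j))).

End Schedules.

(* A deterministic online algorithm.  Knowing the instance data, the batches
   started so far, what has been observed and the current time, it decides to
   start a batch now (on a queue of jobs and a set of machines) or to wait. *)
Definition algorithm (R : realType) : Type :=
  forall I : mUETS R, seq (batch I) -> seq (execution I * R) -> R ->
  option (seq 'I_(njobs I) * {set 'I_(nmach I)}).

(* After the batches [S1], the next batch of [S] is the first one on which [A]
   decides, no earlier than the start of the previous batch. *)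
Definition follows (R : realType) (A : algorithm R) (I : mUETS R)
    (p : 'I_(njobs I) -> R) (S : seq (batch I)) : Prop :=
  forall S1 B S2, S = S1 ++ B :: S2 ->
    (forall t, last 0 [seq bstart B' | B' <- S1] <= t < bstart B ->
       A I S1 (observed p S1 t) t = None) /\
    A I S1 (observed p S1 (bstart B)) (bstart B) = Some (bqueue B, bmach B).

Definition run (R : realType) (A : algorithm R) (I : mUETS R)
    (p : 'I_(njobs I) -> R) (S : seq (batch I)) : Prop :=
  feasible p S /\ follows A p S.

Definition solves (R : realType) (A : algorithm R) (K : set (mUETS R)) : Prop :=
  forall I, K I -> forall p : 'I_(njobs I) -> R, (forall j, 0 <= p j) ->
  exists S, run A p S.

(* In the extended reals, 0 / 0 = 0 and x / 0 = +oo for x > 0. *)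
Definition competitive_ratio (R : realType) (A : algorithm R)
    (K : set (mUETS R)) : \bar R :=
  ereal_sup [set r | exists (I : mUETS R) (p : 'I_(njobs I) -> R) S,
    [/\ K I, forall j, 0 <= p j, run A p S &
        r = ((makespan p S)%:E / (opt_makespan p)%:E)%E]]%classic.

(* Main.v *)
(* Take s types with s jobs each (plus filler jobs) on m >= s machines, where
   m <= 2 s, and run the algorithm with all execution times 0.  If some batch on
   k machines contains more than k * sqrt s jobs of one type, give these jobs
   execution time 1 instead: up to the start of this batch nothing changes for
   the algorithm, so it ends after time sqrt s, whereas the optimum is at most 3
   (each type on its own machine, but one unit job per machine).  Otherwise every
   batch X on k machines has at most k c(X) sqrt s of the s^2 jobs, so the total
   setup time, summed over all machines, is at least s^2 / sqrt s, and the
   makespan is at least s^2 / (m sqrt s) >= sqrt s / 2.  For m machines take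
   s = m and n = m^2; for n jobs take s = floor (sqrt n) and m = max 2 s. *)
Require Import Defs.
From mathcomp Require Import all_boot all_order all_algebra.
From mathcomp Require Import classical_sets reals constructive_ereal ereal exp.
From mathcomp Require Import ring lra zify.
Import Order.TTheory GRing.Theory Num.Theory.
Local Open Scope ring_scope.

Lemma all_le_bigmax {R : realDomainType} {T : Type} (x : R) (F : T -> R) (s : seq T) :
  all (fun e => F e <= \big[Num.max/x]_(e <- s) F e) s.
Proof.
elim: s => //= a s IH; rewrite big_cons le_max lexx /=.
apply: sub_all IH => e He; by rewrite le_max He orbT.
Qed.

(** * How runs depend on the execution times *)

Section Runs.
Context {R : realType} {I : mUETS R}.
Implicit Types (p : 'I_(njobs I) -> R) (S : seq (batch I)) (B : batch I).

Lemma fcfs_eq {p p'} (K : {set 'I_(nmach I)}) free q : {in q, p =1 p'} ->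
  fcfs p K free q = fcfs p' K free q.
Proof.
elim: q free => //= j q IH free pp'; case: pickP => // i _.
rewrite pp' ?mem_head // IH // => k kq.
by apply: pp'; rewrite inE kq orbT.
Qed.

Lemma fcfs_ejob p (K : {set 'I_(nmach I)}) free q :
  all (fun e => ejob e \in q) (fcfs p K free q).
Proof.
elim: q free => //= j q IH free; case: pickP => // i _ /=.
rewrite mem_head /=; apply: sub_all (IH _) => e eq.
by rewrite inE eq orbT.
Qed.

Lemma observed_eq {p p'} S t : {in flatten [seq bqueue B | B <- S], p =1 p'} ->
  observed p S t = observed p' S t.
Proof.
rewrite /observed /trace; elim: S => //= B S IH pp'.
rewrite !filter_cat !map_cat; congr (_ ++ _); last first.
  by apply: IH => j jS; apply: pp'; rewrite mem_cat jS orbT.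
have pp'B : {in bqueue B, p =1 p'} by move=> j jB; apply: pp'; rewrite mem_cat jB.
rewrite /executions (fcfs_eq _ _ _ pp'B).
elim: (fcfs _ _ _ _) (fcfs_ejob p' (bmach B) (fun=> ready B) (bqueue B)) => //= e s IHs.
by case/andP => eB /IHs; case: ifP => //= _ ->; rewrite pp'B.
Qed.


(** Determinism: after the same batches [S1], both runs present the same observations to [A] at
    every time, so [A] takes the same next decision at the same time. *)
Lemma run_next {A p p' S1 B S2 S2'} :
    run A p (S1 ++ B :: S2) -> run A p' (S1 ++ S2') ->
    {in flatten [seq bqueue B | B <- S1], p =1 p'} ->
  exists S3, S2' = B :: S3.
Proof.
move=> [[pth ne uni _ _] fol] [[pth' _ _ all' _] fol'] pp'.
case: S2' pth' all' fol' => [|B' S3] pth' all' fol'.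
  (* The second run cannot stop after [S1]: a job of [B] is in no queue of [S1] and must still be
     scheduled. *)
  have [qB _] := ne _ _ _ erefl.
  move: uni; rewrite map_cat flatten_cat cat_uniq => /and3P[_ /hasPn /= uni _].
  case: (bqueue B) qB uni => // j q _ /(_ j); rewrite inE eqxx => /(_ isT).
  by have := all' j; rewrite cats0 => ->.
exists S3; congr (_ :: _).
have [wait dec] := fol _ _ _ erefl.
have [wait' dec'] := fol' _ _ _ erefl.
have le : last 0 [seq bstart B | B <- S1] <= bstart B.
  by move: pth; rewrite map_cat cat_path => /andP[_ /= /andP[]].
have le' : last 0 [seq bstart B | B <- S1] <= bstart B'.
  by move: pth'; rewrite map_cat cat_path => /andP[_ /= /andP[]].
(* At the earlier of two distinct start times, [A] would both start a batch and wait. *)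
case: (ltgtP (bstart B) (bstart B')) => [lt|lt|eqs].
- by have := wait' (bstart B); rewrite le lt -(observed_eq _ _ pp') dec => /(_ isT).
- by have := wait (bstart B'); rewrite le' lt (observed_eq _ _ pp') dec' => /(_ isT).
move: dec'; rewrite -eqs -(observed_eq _ _ pp') dec => -[].
by case: B B' eqs {pth pth' ne uni fol all' fol' wait wait' dec le le'} => ? ? ? [? ? ?] /= -> -> ->.
Qed.

(* What is observed up to the start of [B] only depends on the execution times
   of the jobs in earlier batches. *)
Lemma run_prefix {A p p' S1 B S2 S'} : run A p (S1 ++ B :: S2) -> run A p' S' ->
    {in flatten [seq bqueue B | B <- S1], p =1 p'} ->
  exists S3, S' = S1 ++ B :: S3.
Proof.
elim/last_ind: S1 B S2 => [|S1 B1 IH] B S2 runS runS' pp'.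
  exact: (run_next runS runS' pp').
have runS1 : run A p (S1 ++ B1 :: B :: S2) by rewrite -cat_rcons.
have [|S3 ES'] := IH B1 (B :: S2) runS1 runS'.
  by move=> j jS; apply: pp'; rewrite map_rcons -cats1 flatten_cat mem_cat jS.
rewrite -cat_rcons in ES'; rewrite ES' in runS' *.

by have [S4 ->] := run_next runS runS' pp'; exists S4.
Qed.

(** * Load bounds for feasible schedules *)

Lemma fcfs_pick (K : {set 'I_(nmach I)}) (free : 'I_(nmach I) -> R) : K != finset.set0 ->
  exists2 i, i \in K & [pick i in K | [forall i' in K, free i <= free i']] = Some i.
Proof.
move=> /set0Pn[i0 Ki0]; case: pickP => [i /andP[Ki _]|no]; first by exists i.
case: (Order.TotalTheory.arg_minP free Ki0) => i Ki min.
by have := no i; rewrite [i \in K]Ki => /negP[]; apply/forall_inP.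
Qed.

(** Executing a job [j] raises the sum of the free times over [K] by exactly [p j], and every free
    time stays at most [M]. *)
Lemma fcfs_load p (K : {set 'I_(nmach I)}) free q M : K != finset.set0 ->
    all (fun e => ecompl e <= M) (fcfs p K free q) ->
    {in K, forall i, free i <= M} ->
  \sum_(i in K) free i + \sum_(j <- q) p j <= #|K|%:R * M.
Proof.
move=> K0; elim: q free => [|j q IH] free /= Hq HK.
  by rewrite big_nil addr0 mulr_natl -sumr_const ler_sum.
have [i Ki Epick] := fcfs_pick K free K0.
move: Hq; rewrite Epick /= => /andP[Hi /IH].
have -> : \sum_(k in K) [eta free with i |-> free i + p j] k
    = \sum_(k in K) free k + p j.
  rewrite !(bigD1 i Ki) /= eqxx addrAC; congr (_ + _ + _).
  by apply: eq_bigr => k /andP[_ /negPf] /= ->.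
rewrite big_cons addrA; apply => k Kk /=.
by case: eqP => // _; apply: HK.
Qed.

Section Feasible.
Context {p S}.
Hypotheses (p_ge0 : forall j, 0 <= p j) (feasS : feasible p S).

Lemma executions_le_makespan {S1 B S2} : S = S1 ++ B :: S2 ->
  all (fun e => ecompl e <= makespan p S) (executions p B).
Proof.
move=> ES; have: all (fun e => ecompl e <= makespan p S) (trace p S).
  exact: all_le_bigmax.
have -> : trace p S = trace p S1 ++ executions p B ++ trace p S2.
  by rewrite ES /trace map_cat flatten_cat.
by rewrite !all_cat => /and3P[].
Qed.

Lemma ready_le_makespan {S1 B S2} : S = S1 ++ B :: S2 -> ready B <= makespan p S.
Proof.
move=> ES; have [_ ne _ _ _] := feasS; have [qB mB] := ne _ _ _ ES.
have := executions_le_makespan ES; rewrite /executions.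
case: (bqueue B) qB => //= j q _.
have [i _ ->] := fcfs_pick _ (fun=> ready B) mB.
by move=> /andP[+ _]; apply: le_trans; rewrite lerDl.
Qed.

Lemma batch_load {S1 B S2} : S = S1 ++ B :: S2 ->
  #|bmach B|%:R * ready B + \sum_(j <- bqueue B) p j
    <= #|bmach B|%:R * makespan p S.
Proof.
move=> ES; have [_ ne _ _ _] := feasS; have [_ mB] := ne _ _ _ ES.
rewrite [X in X + _]mulr_natl -sumr_const.
by apply: fcfs_load (executions_le_makespan ES) _ => // i _; apply: ready_le_makespan ES.
Qed.

Lemma bstart_ge0 {S1 B S2} : S = S1 ++ B :: S2 -> 0 <= bstart B.
Proof.
have [pth _ _ _ _] := feasS.
by move=> ES; move: (order_path_min le_trans pth); rewrite ES map_cat all_cat /= => /and3P[].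
Qed.

(** The batches that use machine [i] occupy it one after the other, each for at least its setup
    time. *)
Lemma machine_setup i :
  \sum_(B <- S | i \in bmach B) setup [set j in bqueue B] <= makespan p S.
Proof.
have [_ _ _ _ disj] := feasS.
(* For the induction, [a] is a time before which none of the remaining batches on [i] starts; after
   a batch [B] on [i] it becomes [ready B], which is at most [release B i]. *)
suff aux S1 S2 a : S = S1 ++ S2 -> a <= makespan p S ->
    (forall S3 B S4, S2 = S3 ++ B :: S4 -> i \in bmach B -> a <= bstart B) ->
    a + \sum_(B <- S2 | i \in bmach B) setup [set j in bqueue B] <= makespan p S.
  rewrite -[X in X <= _]add0r; apply: (aux [::]) => //.
    exact: bigmax_ge_id.
  by move=> S3 B S4 ES _; apply: bstart_ge0 ES.
elim: S2 S1 a => [|B S2 IH] S1 a ES aM Ha.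
  by rewrite big_nil addr0.
rewrite big_cons; case: ifP => iB; last first.
  apply: (IH (rcons S1 B)) => //; first by rewrite cat_rcons.
  by move=> S3 B' S4 E; apply: (Ha (B :: S3)); rewrite E.
apply: (@le_trans _ _ (ready B + \sum_(B <- S2 | i \in bmach B) setup [set j in bqueue B])).
  by rewrite addrA lerD2r /ready lerD2r; apply: (Ha [::]).
apply: (IH (rcons S1 B)).
- by rewrite cat_rcons.
- exact: ready_le_makespan ES.
move=> S3 B' S4 E iB'.
have := disj S1 B S3 B' S4 i; rewrite ES E => /(_ erefl iB iB').
by apply: le_trans; apply: bigmax_ge_id.
Qed.

Lemma total_setup :
  \sum_(B <- S) #|bmach B|%:R * setup [set j in bqueue B] <= (nmach I)%:R * makespan p S.
Proof.
under eq_bigr => B _ do rewrite mulr_natl -sumr_const big_mkcond.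
rewrite exchange_big /= -[X in X%:R * _]card_ord mulr_natl -sumr_const.
apply: ler_sum => i _; rewrite -big_mkcond; exact: machine_setup.
Qed.
End Feasible.

(** * Bounds on the optimal makespan *)

Lemma opt_makespan_ge0 p : 0 <= opt_makespan p.
Proof.
apply: lb_le_inf; last by move=> _ [f _ <-]; apply: bigmax_ge_id.
pose f0 : {ffun 'I_(njobs I) -> 'I_(nmach I)} := [ffun=> Ordinal (ltnW (nmach_ge2 I))].
by eexists; exists f0.
Qed.

Lemma opt_makespan_le p (f : 'I_(njobs I) -> 'I_(nmach I)) M : 0 <= M ->
    (forall i, setup [set j | f j == i] + \sum_(j | f j == i) p j <= M) ->
  opt_makespan p <= M.
Proof.
move=> M_ge0 fM.
apply: (@le_trans _ _ (\big[Num.max/0]_(i < nmach I)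
  (setup [set j | finfun f j == i] + \sum_(j | finfun f j == i) p j))).
  apply: ge_inf; last by exists (finfun f).
  by exists 0 => _ [g _ <-]; apply: bigmax_ge_id.
apply: bigmax_le => // i _; have := fM i.
rewrite (_ : [set j | f j == i] = [set j | finfun f j == i]); last first.
  by apply/setP => j; rewrite !inE ffunE.
by rewrite (eq_bigl (fun j => finfun f j == i)) // => j; rewrite ffunE.
Qed.
End Runs.

(** * Instances given by a type function *)

Section TypedInstance.
Context {R : realType} {n m : nat} {T : finType} (ty : 'I_n -> T).
Hypotheses (m_ge2 : (2 <= m)%N) (mn : (m <= n)%N).

Let c (X : {set 'I_n}) : R := #|ty @: X|%:R.

Lemma typed_setup_ge0 X : 0 <= c X.
Proof. exact: ler0n. Qed.

Lemma typed_setup_mono (X Y : {set 'I_n}) : X \subset Y -> c X <= c Y.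
Proof. by move=> XY; rewrite ler_nat subset_leq_card // imsetS. Qed.

Lemma typed_setup_subadd (X Y : {set 'I_n}) : [disjoint X & Y] -> c (X :|: Y) <= c X + c Y.
Proof. by move=> _; rewrite -natrD ler_nat imsetU cardsU leq_subr. Qed.

Definition typed_instance : mUETS R :=
  MUETS m_ge2 mn typed_setup_ge0 typed_setup_mono typed_setup_subadd.

Lemma typed_instance_unweighted : unweighted_types typed_instance.
Proof.
exists (preim_partition ty [set: 'I_n]); first exact: preim_partitionP.
move=> X; congr _%:R => /=.
pose blk t := [set y in [set: 'I_n] | t == ty y].
(* The blocks that meet [X] are the classes of the types occurring in [X]; on these types [blk] is
   injective because their classes are nonempty. *)
have -> : [set B in preim_partition ty [set: 'I_n] | X :&: B != finset.set0]
    = blk @: (ty @: X).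
  apply/setP => B; rewrite inE; apply/andP/imsetP => [[]|[_ /imsetP[x xX ->] ->]].
    move=> /imsetP[x _ ->] /set0Pn[y]; rewrite !inE => /andP[yX /eqP xy].
    by exists (ty y); [exact: imset_f|rewrite -xy].
  split; first by apply/imsetP; exists x.
  by apply/set0Pn; exists x; rewrite !inE xX eqxx.
rewrite [RHS]card_in_imset // => t u /imsetP[x xX ->] _ /setP/(_ x).
by rewrite !inE eqxx => /esym/eqP.
Qed.
End TypedInstance.

(** * The adversary *)

Section Adversary.
Context {R : realType} {A : algorithm R} {n m s : nat}.
Hypotheses (m_ge2 : (2 <= m)%N) (mn : (m <= n)%N).
Hypotheses (s_gt0 : (0 < s)%N) (sm : (s <= m)%N) (m2s : (m <= 2 * s)%N).
Hypothesis (ssn : (s * s <= n)%N).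

Lemma type_subproof (j : 'I_n) : (minn (j %/ s) s.-1 < m)%N.
Proof. by apply: leq_trans sm; rewrite -[ltnRHS](prednK s_gt0) ltnS geq_minr. Qed.

Lemma slot_subproof (j : 'I_n) : (j %% s < m)%N.
Proof. by apply: leq_trans sm; rewrite ltn_pmod. Qed.

(* The jobs j < s * s form an s x s grid with rows [ty] and columns [slot]; the
   filler jobs j >= s * s all have the last type. *)
Let ty (j : 'I_n) := Ordinal (type_subproof j).
Let slot (j : 'I_n) := Ordinal (slot_subproof j).
Let core := [set j : 'I_n | (j < s * s)%N].
Let I : mUETS R := typed_instance ty m_ge2 mn.
Let p (V : {set 'I_n}) (j : 'I_(njobs I)) : R := (j \in V)%:R.

Lemma card_core : #|core| = (s * s)%N.
Proof.
have -> : core = [set widen_ord ssn i | i : 'I_(s * s)].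
  apply/setP => j; rewrite inE; apply/idP/imsetP => [lt|[i _ ->]]; last exact: (ltn_ord i).
  by exists (Ordinal lt) => //; apply: val_inj.
rewrite card_imset ?card_ord // => i j /(congr1 val) /= ij.
exact: val_inj.
Qed.

Lemma core_inj (j k : 'I_n) : j \in core -> k \in core ->
  ty j = ty k -> slot j = slot k -> j = k.
Proof.
rewrite !inE -!ltn_divLR // => jc kc /(congr1 val) /= tjk /(congr1 val) /= sjk.
apply: val_inj; rewrite /= (divn_eq j s) (divn_eq k s) sjk; congr (_ * _ + _)%N.
by move: tjk jc kc s_gt0; lia.
Qed.

Lemma opt_one_type (V : {set 'I_n}) t : {in V, forall j, (j \in core) && (ty j == t)} ->
  opt_makespan (p V) <= 3.
Proof.
move=> Vt; apply: (@opt_makespan_le R I _ (fun j => if j \in V then slot j else ty j)) => // i.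
(* Machine [i] only receives jobs of types [i] and [t], hence setup at most 2. Two jobs of [V] on it
   would share type and slot, hence load at most 1. *)
have -> : 3 = 2 + 1 :> R by lra.
apply: lerD; rewrite /= ?/p -?natr_sum ?ler_nat ?(ler_nat _ _ 1).
  apply: (@leq_trans #|[set (i : 'I_m); t]|); last by rewrite cards2; case: eqP.
  apply: subset_leq_card; apply/fintype.subsetP => u /imsetP[j + ->]; rewrite !inE.
  case: ifP => [/Vt/andP[_ ->]|_ -> //]; by rewrite orbT.
under eq_bigr => j _ do rewrite (_ : (j \in V : nat) = if j \in V then 1%N else 0%N) //.
rewrite -big_mkcondr sum1_card; apply/card_le1_eqP => j k.
rewrite !unfold_in => /andP[+ jV] /andP[+ kV]; rewrite jV kV => /eqP sj /eqP sk.
have /andP[jc /eqP tj] := Vt _ jV; have /andP[kc /eqP tk] := Vt _ kV.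
by apply: core_inj; rewrite ?tj ?tk // sk sj.
Qed.

(** Fillers are left out: each shares type and slot with a core job, so unit fillers would spoil the
    bound on the optimum. *)
Let block (B : batch I) t := [set j in bqueue B | (j \in core) && (ty j == t)].
Let heavy (B : batch I) :=
  [exists t, #|bmach B|%:R * Num.sqrt (s%:R : R) < #|block B t|%:R].

(** Split the core jobs of each batch by type: there are at most [setup] many types, each with at
    most [#|bmach B| * sqrt s] core jobs. *)
Lemma light_setup (S : seq (batch I)) : all (predC heavy) S ->
  #|[set j in flatten [seq bqueue B | B <- S]] :&: core|%:R
    <= Num.sqrt s%:R * \sum_(B <- S) #|bmach B|%:R * setup [set j in bqueue B].
Proof.
elim: S => [|B S IH] /=.
  rewrite big_nil mulr0 (_ : _ :&: _ = finset.set0) ?cards0 //.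
  by apply/setP => j; rewrite !inE.
move=> /andP[lB /IH {}IH]; rewrite big_cons mulrDr.
have -> : [set j in bqueue B ++ flatten [seq bqueue B | B <- S]] :&: core
    = ([set j in bqueue B] :&: core) :|: ([set j in flatten [seq bqueue B | B <- S]] :&: core).
  by apply/setP => j; rewrite !inE mem_cat andb_orl.
apply: (le_trans (y := #|[set j in bqueue B] :&: core|%:R
    + #|[set j in flatten [seq bqueue B | B <- S]] :&: core|%:R)).
  by rewrite -natrD ler_nat cardsU leq_subr.
apply: lerD IH.
rewrite mulrCA mulrA mulr_natr -[X in X%:R <= _]sum1_card.
rewrite (partition_big ty (mem (ty @: [set j in bqueue B]))) => [|j]; last first.
  by rewrite inE => /andP[jB _]; apply: imset_f.
rewrite natr_sum -sumr_const; apply: ler_sum => t _; rewrite sum1_card.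
move: lB; rewrite negb_exists => /forallP/(_ t); rewrite -leNgt; apply: le_trans.
by rewrite ler_nat; apply/subset_leq_card/fintype.subsetP => j; rewrite unfold_in !inE andbA.
Qed.

Lemma bad_instance : solves A [set I | unweighted_types I]%classic ->
  exists (p : 'I_(njobs I) -> R) S, [/\ forall j, 0 <= p j, run A p S,
    opt_makespan p <= 3 & Num.sqrt s%:R <= 2 * makespan p S].
Proof.
have p_ge0 V (j : 'I_(njobs I)) : 0 <= p V j by exact: ler0n.
move=> solA; have solI V := solA I (typed_instance_unweighted ty m_ge2 mn) (p V) (p_ge0 V).
have [S runS] := solI finset.set0; have [feasS folS] := runS.
have M_ge0 V S' : 0 <= makespan (p V) S' by exact: bigmax_ge_id.
have [hS|lS] := boolP (has heavy S).
  case: (split_find hS) runS => B S1 S2 /existsP[t hB] _; rewrite cat_rcons => runS.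
  have [S' runS'] := solI (block B t).
  have [|S3 ES'] := run_prefix runS runS'.
    (* A job started before [B] is not in [B], so its execution time is 0 in both instances. *)
    move=> j jS1; rewrite /p inE [in RHS]inE.
    have jB : j \notin bqueue B.
      have [[_ _ + _ _] _] := runS; rewrite map_cat flatten_cat cat_uniq => /and3P[_ /hasPn out _].
      by apply: contraL jS1 => jB; apply: out; rewrite /= mem_cat jB.
    by rewrite (negPf jB).
  exists (p (block B t)), S'; split => //.
    by apply: (@opt_one_type _ t) => j; rewrite inE => /andP[].
  have := batch_load (p := p (block B t)) (p_ge0 (block B t)) runS'.1 ES'.
  have count_block : #|block B t|%:R <= \sum_(j <- bqueue B) p (block B t) j.
    rewrite -natr_sum ler_nat.
    under eq_bigr => j _ do rewrite (_ : (j \in block B t : nat) = if j \in block B t then 1%N else 0%N) //.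
    rewrite -big_mkcond sum1_count -size_filter; apply: leq_trans (card_size _).
    by apply/subset_leq_card/fintype.subsetP => j jV; rewrite mem_filter jV; move: jV; rewrite inE => /andP[].
  have ready_ge0 : 0 <= ready B by rewrite addr_ge0 ?setup_ge0 // (bstart_ge0 runS'.1 ES').
  have := mulr_ge0 (ler0n R #|bmach B|) ready_ge0.
  move: hB count_block; have := M_ge0 (block B t) S'; set M := makespan _ _ => *.
  suff: Num.sqrt s%:R < M by lra.
  (* With [k] machines, [M <= sqrt s] would give [k * M <= k * sqrt s < #|block B t| <= k * M]. *)
  rewrite ltNge; apply/negP => /(ler_wpM2l (ler0n R #|bmach B|)); lra.
exists (p finset.set0), S; split => //.
  have m_gt0 : (0 < m)%N by apply: leq_trans m_ge2.
  by apply: (@opt_one_type _ (Ordinal m_gt0)) => j; rewrite inE.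
move: lS; rewrite -all_predC => /light_setup; have := total_setup (p := p finset.set0) (p_ge0 _) feasS.
rewrite [nmach I]/= (_ : _ :&: core = core); last first.
  by apply/finset.setIidPr/fintype.subsetP => j _; rewrite inE; have [_ _ _ + _] := feasS.
rewrite card_core natrM; set M := makespan _ _; set Q := \sum_(B <- S) _.
have : Num.sqrt (s%:R : R) ^+ 2 = s%:R by apply: sqr_sqrtr.
have : 0 < Num.sqrt (s%:R : R) by rewrite sqrtr_gt0 ltr0n.
have : m%:R <= 2 * s%:R :> R by rewrite -natrM ler_nat.
have := M_ge0 finset.set0 S; rewrite -/M.
move: (Num.sqrt _) => r M0 ms r0 rs; rewrite -rs in ms * => Qm rQ.
(* If [2 * M < r], then [r ^+ 4 <= r * Q <= r * m * M <= 2 * r ^+ 3 * M < r ^+ 4]. *)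
rewrite leNgt; apply/negP => Mr.
have rQm := ler_wpM2l (ltW r0) Qm.
have mM := ler_wpM2r M0 ms.
have r3 : 0 < r ^+ 3 by rewrite exprn_gt0.
have : r * (m%:R * M) <= r * (2 * r ^+ 2 * M) by rewrite ler_pM2l.
have : r ^+ 3 * (2 * M) < r ^+ 3 * r by rewrite ltr_pM2l.
lra.
Qed.

End Adversary.

(** * From bad instances to competitive ratios *)

Lemma competitive_ratio_ge {R : realType} {A : algorithm R} {K : set (mUETS R)}
    {I : mUETS R} {p : 'I_(njobs I) -> R} {S r} :
    K I -> (forall j, 0 <= p j) -> run A p S ->
    opt_makespan p <= 3 -> 0 < r -> r <= 2 * makespan p S ->
  ((r / 6)%:E <= competitive_ratio A K)%E.
Proof.
move=> KI p_ge0 runS opt3 r_gt0 rM.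
apply: (@Order.POrderTheory.le_trans _ _ ((makespan p S)%:E / (opt_makespan p)%:E)%E); last first.
  by apply: ereal_sup_ubound; exists I, p, S.
have M_gt0 : 0 < makespan p S by lra.
(* If the optimum is 0, the ratio is [+oo] because the makespan is positive. *)
rewrite inver; case: eqP => [_|/eqP opt0]; first by rewrite gt0_muley ?lte_fin // leey.
have opt_gt0 : 0 < opt_makespan p by rewrite lt_neqAle eq_sym opt0 opt_makespan_ge0.
rewrite -EFinM lee_fin ler_pdivlMr //.
apply: le_trans (_ : r / 6 * 3 <= _); last by lra.
by rewrite ler_wpM2l // divr_ge0 // ltW.
Qed.

Theorem theorem10 (R : realType) :
  exists2 C : R, 0 < C &
    forall A : algorithm R, solves A [set I | unweighted_types I]%classic ->
      (forall m : nat, (2 <= m)%N ->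
        ((C * Num.sqrt m%:R)%:E <=
          competitive_ratio A [set I | unweighted_types I /\ nmach I = m]%classic)%E) /\
      (forall n : nat, (2 <= n)%N ->
        ((C * n%:R `^ (4^-1))%:E <=
          competitive_ratio A [set I | unweighted_types I /\ njobs I = n]%classic)%E).
Proof.
(* The ratio is at least [sqrt s / 6]; the other factor 2 pays for rounding [sqrt n] down to [s]. *)
exists (1 / 12) => [|A solA]; first by lra.
split=> [m m_ge2|n n_ge2].
  have m_gt0 : (0 < m)%N by lia.
  have mm : (m <= m * m)%N by rewrite leq_pmulr.
  have m2m : (m <= 2 * m)%N by lia.
  have [p [S [p_ge0 runS opt3 rM]]] :=
    bad_instance m_ge2 mm m_gt0 (leqnn m) m2m (leqnn _) solA.
  have r_gt0 : 0 < Num.sqrt (m%:R : R) by rewrite sqrtr_gt0 ltr0n.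
  apply: le_trans (competitive_ratio_ge _ p_ge0 runS opt3 r_gt0 rM); last first.
    by split=> //; apply: typed_instance_unweighted.
  rewrite lee_fin; lra.
have [s [s_gt0 ssn ns]] : exists s : nat, [/\ (0 < s)%N, (s * s <= n)%N & (n < s.+1 * s.+1)%N].
  have ex : exists s : nat, (s * s <= n)%N by exists 0%N.
  have bnd (s : nat) : (s * s <= n)%N -> (s <= n)%N by nia.
  case: (ex_maxnP ex bnd) => s ssn smax; exists s; split => //.
    by apply: smax; lia.
  by rewrite ltnNge; apply/negP => /smax; rewrite ltnn.
(* The maximum with 2 matters for [n < 4], where [s = 1]. *)
have m_ge2 : (2 <= maxn 2 s)%N by lia.
have mn : (maxn 2 s <= n)%N by nia.
have sm : (s <= maxn 2 s)%N by lia.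
have m2s : (maxn 2 s <= 2 * s)%N by lia.
have [p [S [p_ge0 runS opt3 rM]]] := bad_instance m_ge2 mn s_gt0 sm m2s ssn solA.
have r_gt0 : 0 < Num.sqrt (s%:R : R) by rewrite sqrtr_gt0 ltr0n.
apply: le_trans (competitive_ratio_ge _ p_ge0 runS opt3 r_gt0 rM); last first.
  by split=> //; apply: typed_instance_unweighted.
have r2 : Num.sqrt (s%:R : R) ^+ 2 = s%:R by apply: sqr_sqrtr.
set r := Num.sqrt _ in r_gt0 r2 *.
suff : n%:R `^ 4^-1 <= 2 * r by rewrite lee_fin; lra.
have r20 : 0 <= 2 * r by lra.
(* Compare fourth powers: [n < (s + 1)^2 <= 16 * s^2 = (2 * r)^4]. *)
rewrite -[leRHS]powRr1 // -[X in _ <= _ `^ X](@divff R 4) // powRrM powR_mulrn //.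
apply: ge0_ler_powR; rewrite ?invr_ge0 ?nnegrE ?exprn_ge0 //.
have -> : (2 * r) ^+ 4 = (16 * (s * s))%:R by rewrite !natrM -r2; ring.
by rewrite ler_nat; nia.
Qed.
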